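(* Let $S\in\mathbb N$, let $n_0\in\mathbb N_0$ and $n_1,\dots,n_S\in\mathbb N$, and write $\vec n_S=[n_0,n_1,\dots,n_S]$. Consider the Collatz word $$CW(\vec n_S)=d^{n_0}\,s\,d^{n_1-1}\,s\,d^{n_2-1}\cdots s\,d^{n_S-1}.$$ Put $\hat D(S)=1+\sum_{j=0}^{S-1}n_j$, $D(S)=\sum_{j=0}^{S}n_j$ and $c_{new}(S)=-N(S)$, where $M(S)$ and $N(S)$ are the integers defined recursively in the context. Then for every $k\in\mathbb N_0$ the corresponding Collatz sequence $CS(\vec n_S;k)$ realizing $CW(\vec n_S)$, of length $L(S)=D(S)+S+1$, has first entry $M(\vec n_S;k)$ and last entry $N(\vec n_S;k)$ given by $$M(\vec n_S;k)=M(S)-2^{\hat D(S)}\,N(S)\,x_0(S,n_S-1)+2^{D(S)}\,t_{min}(S,n_S-1;c_{new}(S))+2^{D(S)}\,k,$$ $$N(\vec n_S;k)=c_{new}(S)\,y_0(S,n_S-1)+3^S\,t_{min}(S,n_S-1;c_{new}(S))+3^S\,k.$$ That is, for every $k\in\mathbb N_0$ the number $M(\vec n_S;k)$ is a positive integer, the sequence of length $L(S)$ obtained from it by iterating the Collatz map realizes the word $CW(\vec n_S)$, and the last entry of that sequence is $N(\vec n_S;k)$.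
   Context: $\mathbb N=\{1,2,\dots\}$, $\mathbb N_0=\mathbb N\cup\{0\}$. The Collatz map sends an odd $m$ to $3m+1$ and an even $m$ to $m/2$. A Collatz word is a finite word in the letters $u,d$, read from left to right, and $s$ abbreviates $ud$. A sequence $[c_1,\dots,c_L]$ realizes a word of $L-1$ letters (after expanding each $s$ as $ud$) if for each $i$: when the $i$-th letter is $u$, $c_i$ is odd and $c_{i+1}=3c_i+1$; when the $i$-th letter is $d$, $c_i$ is even and $c_{i+1}=c_i/2$. Such a sequence is called a Collatz sequence for the word and is determined by its first entry; $CS(\vec n_S;k)$, $k\in\mathbb N_0$, denotes a family, indexed by $k$, of such sequences of positive integers. For $m\in\mathbb N$ and $n\in\mathbb N_0$, $y_0(m,n)$ is the element of $\{1,\dots,3^m-1\}$ congruent to $\left(\frac{3^m+1}{2}\right)^{n+3^{m-1}}$ modulo $3^m$, and $x_0(m,n)=\frac{1+2^n y_0(m,n)}{3^m}$ (a positive integer). For an integer $c$, $$t_{min}(m,n;c)=\lceil |c|\,x_0(m,n)/2^n\rceil\ \text{ if } c<0,\qquad t_{min}(m,n;c)=\lceil -c\,y_0(m,n)/3^m\rceil\ \text{ if } c\ge 0.$$ The integers $M(i)$, $\widetilde N(i)$, $N(i)=\widetilde N(i)+2$ for $1\le i\le S$ are defined by $M(1)=2^{n_0}$, $\widetilde N(1)=0$ and, for $2\le i\le S$, $$M(i)=M(i-1)+2^{\hat D(i-1)}\,c(i-1)\,x_0(i-1,n_{i-1}),\qquad \widetilde N(i)=3\,y_0(i-1,n_{i-1})\,c(i-1),$$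 where $\hat D(i)=1+\sum_{j=0}^{i-1}n_j$ and $c(i)=2(2^{n_i-2}-1)-\widetilde N(i)$. *)

(* Defs.v *)
From mathcomp Require Import all_boot all_order all_algebra.

Set Implicit Arguments.
Unset Strict Implicit.
Unset Printing Implicit Defensive.

Import Order.TTheory GRing.Theory Num.Theory.
Local Open Scope ring_scope.

Inductive letter := u | d.

Definition s : seq letter := [:: u; d].

Definition collatz (m : int) : int :=
  if (2 %| m)%Z then (m %/ 2)%Z else 3 * m + 1.

Definition realizes (w : seq letter) (c : seq int) : Prop :=
  size c = (size w).+1 /\
  forall i : nat, (i < size w)%N ->
    match nth d w i with
    | u => ~~ (2 %| c`_i)%Z /\ c`_i.+1 = 3 * c`_i + 1
    | d => (2 %| c`_i)%Z /\ c`_i.+1 = (c`_i %/ 2)%Z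
    end.

(* For m >= 1 the residue below is nonzero, because (3^m+1)/2 is the inverse
   of 2 modulo 3^m; it therefore lies in {1, ..., 3^m - 1}. *)
Definition y0 (m n : nat) : nat :=
  ((((3 ^ m + 1) %/ 2) ^ (n + 3 ^ m.-1)) %% 3 ^ m)%N.

(* The division is exact for m >= 1: 2^n * y0 m n is congruent modulo 3^m to
   the inverse of 2^(3^(m-1)), and 2^(3^(m-1)) is congruent to -1. *)
Definition x0 (m n : nat) : nat := ((1 + 2 ^ n * y0 m n) %/ 3 ^ m)%N.

Definition tmin (m n : nat) (c : int) : int :=
  if c < 0 then Num.ceil (`|c|%:~R * (x0 m n)%:R / 2 ^+ n : rat)
  else Num.ceil ((- c)%:~R * (y0 m n)%:R / 3 ^+ m : rat).

(* A vector [n_0, ..., n_S] is represented by a function n : nat -> nat, of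
   which only the values at 0, ..., S are ever used. *)

Definition D (n : nat -> nat) (i : nat) : nat := (\sum_(0 <= j < i.+1) n j)%N.

Definition Dhat (n : nat -> nat) (i : nat) : nat :=
  (1 + \sum_(0 <= j < i) n j)%N.

(* 2^(ni - 1) - 2 is 2 (2^(ni - 2) - 1), written so as to be an integer
   expression also when ni = 1. *)
Definition c_of (ni : nat) (Nti : int) : int := 2 ^+ ni.-1 - 2 - Nti.

(* The recursions start at i = 1; the values at i = 0 are irrelevant. *)
Fixpoint Ntilde (n : nat -> nat) (i : nat) : int :=
  match i with
  | 0 | 1 => 0
  | j.+1 => 3 * (y0 j (n j))%:Z * c_of (n j) (Ntilde n j)
  end.

Definition c (n : nat -> nat) (i : nat) : int := c_of (n i) (Ntilde n i).

Fixpoint M (n : nat -> nat) (i : nat) : int :=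
  match i with
  | 0 | 1 => 2 ^+ n 0%N
  | j.+1 => M n j + 2 ^+ Dhat n j * c n j * (x0 j (n j))%:Z
  end.

Definition N (n : nat -> nat) (i : nat) : int := Ntilde n i + 2.

Definition c_new (n : nat -> nat) (S : nat) : int := - N n S.

Definition CW (n : nat -> nat) (S : nat) : seq letter :=
  nseq (n 0%N) d ++ flatten [seq s ++ nseq (n i).-1 d | i <- iota 1 S].

Definition L (n : nat -> nat) (S : nat) : nat := (D n S + S + 1)%N.

Definition M_first (n : nat -> nat) (S k : nat) : int :=
  M n S - 2 ^+ Dhat n S * N n S * (x0 S (n S).-1)%:Z
  + 2 ^+ D n S * tmin S (n S).-1 (c_new n S) + 2 ^+ D n S * k%:Z.

Definition N_last (n : nat -> nat) (S k : nat) : int :=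
  c_new n S * (y0 S (n S).-1)%:Z
  + 3 ^+ S * tmin S (n S).-1 (c_new n S) + 3 ^+ S * k%:Z.

Definition CS (n : nat -> nat) (S k : nat) : seq int :=
  traject collatz (M_first n S k) (L n S).

(* Main.v *)
Require Import Defs.
From mathcomp Require Import all_boot all_order all_algebra.
From mathcomp Require Import zify ring.

Import Order.TTheory GRing.Theory Num.Theory.
Local Open Scope ring_scope.

(** The initial values realizing a word, together with the final values they
    lead to, form a pair of arithmetic progressions with a common parameter.
    For the word [d^(n_0) s d^(n_1 - 1) s ... d^(n_(i-1) - 1) s], ending in its
    [i]-th [s], the value [M(i) + 2^(Dhat(i)) t] leads to [N(i) + 3^i t] for
    every integer [t] ([run_CW_s]).  Appending [d^r] requires
    [N(i) + 3^i t = 2^r t'], where moreover [t'] must be odd if another [s] is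
    to follow.  Either requirement is a linear Diophantine equation
    [3^i t - 2^n w = c], with [w = t'] and [n = r] in the first case,
    [t' = 2 w + 1] and [n = r + 1] in the second.  Its solutions are
    [t = c x_0 + 2^n z], [w = c y_0 + 3^i z], because
    [3^i x_0(i,n) = 1 + 2^n y_0(i,n)] ([x0_y0]).  That identity expresses that
    [y_0] is minus the inverse of [2^n] modulo [3^i], and it rests on
    [h^(3^(i-1)) = -1] modulo [3^i] for [h = (3^i + 1) / 2], a consequence of
    [h = -1] modulo [3] ([dvdz_exp3_add1]).

    With [c = - N(S)] and [z = t_min + k] one gets the stated first and last
    entries.  The choice of [t_min] makes the last entry positive
    ([tmin_last_gt0]): for [c < 0] because [3^m x_0 > 2^n y_0], and for
    [c >= 0] because it is nonnegative and, [3] dividing neither [c] nor [y_0],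
    nonzero.  A run of the Collatz map ending in a positive integer starts from
    a positive integer ([run_gt0]), so the first entry is positive too, although
    [M(S)] itself can be negative. *)

(** * Runs of the Collatz map *)

(** [run w a b]: starting from [a], the steps prescribed by [w] are the ones
    taken by the Collatz map, and they lead to [b].  Parity is built into the
    shape of the starting value. *)
Inductive run : seq letter -> int -> int -> Prop :=
| run_nil a : run [::] a a
| run_u w a b : run w (3 * (2 * a + 1) + 1) b -> run (u :: w) (2 * a + 1) b
| run_d w a b : run w a b -> run (d :: w) (2 * a) b.

Lemma run_cat w1 w2 a b c : run w1 a b -> run w2 b c -> run (w1 ++ w2) a c.
Proof.
by move=> r12; elim: r12 => //= {}w1 {}a {}b _ IH /IH; constructor.
Qed.

Arguments run_cat {w1 w2 a b c}.

Lemma run_nseq_d r a : run (nseq r d) (2 ^+ r * a) a.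
Proof.
elim: r => [|r IH] /=; first by rewrite expr0 mul1r; constructor.
by rewrite exprS -mulrA; constructor.
Qed.

Lemma run_s a : run s (2 * a + 1) (3 * a + 2).
Proof.
constructor; have -> : 3 * (2 * a + 1) + 1 = 2 * (3 * a + 2) :> int by ring.
by do 2!constructor.
Qed.

Lemma run_gt0 w a b : run w a b -> 0 < b -> 0 < a.
Proof.
by elim=> // {}w {}a {}b _ IH /IH; lia.
Qed.

Lemma dvd2_odd (a : int) : (2 %| 2 * a + 1)%Z = false.
Proof. by lia. Qed.

Lemma run_realizes w a b : run w a b ->
  realizes w (traject collatz a (size w).+1) /\
  last 0 (traject collatz a (size w).+1) = b.
Proof.
have collatz_odd (z : int) : collatz (2 * z + 1) = 3 * (2 * z + 1) + 1.
  by rewrite /collatz dvd2_odd.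
have collatz_even (z : int) : collatz (2 * z) = z.
  by rewrite /collatz dvdz_mulr // mulKz.
elim=> [a0|{}w {}a {}b _ [[_ IH] IHl]|{}w {}a {}b _ [[_ IH] IHl]].
- by split; first split.
- split; last by move: IHl; rewrite !trajectS /= collatz_odd.
  split; first by rewrite size_traject.
  move=> [_|i lt_i]; first by split; [rewrite dvd2_odd | apply: collatz_odd].
  by move: (IH i lt_i); rewrite -collatz_odd; apply.
- split; last by move: IHl; rewrite !trajectS /= collatz_even.
  split; first by rewrite size_traject.
  move=> [_|i lt_i]; first by
    split; rewrite ?dvdz_mulr // mulKz // -[RHS]collatz_even.
  by move: (IH i lt_i); rewrite -[a in traject _ a]collatz_even; apply.
Qed.

(** * The Diophantine identity between [x0] and [y0] *)

(** Raising to the third power gains a factor [3], as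
    [b^3 + 1 = (b + 1) (b^2 - b + 1)] and [3] divides [b^2 - b + 1] when
    [b = -1] modulo [3]. *)
Lemma dvdz_exp3_add1 (a : int) (m : nat) :
  (3 %| a + 1)%Z -> (3 ^+ m.+1 %| a ^+ (3 ^ m) + 1)%Z.
Proof.
move=> dvd3; elim: m => [|m IH]; first by rewrite expn0 !expr1.
set b : int := a ^+ (3 ^ m) in IH.
have -> : a ^+ (3 ^ m.+1) + 1 = (b ^+ 2 - b + 1) * (b + 1).
  by rewrite expnSr exprM -/b; ring.
rewrite exprS dvdz_mul //.
have /dvdzP[q bq] : (3 %| b + 1)%Z.
  by apply: dvdz_trans IH; rewrite exprS dvdz_mulr.
have -> : b = q * 3 - 1 by rewrite -bq addrK.
by apply/dvdzP; exists (3 * q ^+ 2 - 3 * q + 1); ring.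
Qed.

Lemma PoszX (a m : nat) : (a ^ m)%:Z = a%:Z ^+ m.
Proof. by rewrite -natz natrX natz. Qed.

(** The division in the definition of [x0] is exact. *)
Lemma dvdn_x0_numerator m n :
  (0 < m)%N -> (3 ^ m %| 1 + 2 ^ n * y0 m n)%N.
Proof.
case: m => // m _; set h := ((3 ^ m.+1 + 1) %/ 2)%N.
have h2 : (2 * h = 3 ^ m.+1 + 1)%N.
  rewrite mulnC divnK // dvdn2 oddD oddX; by [].
have h3 : (3 %| h%:Z + 1)%Z.
  by move: h2; rewrite expnS; move: (3 ^ m)%N => q; lia.
have := dvdz_exp3_add1 (h%:Z) m h3.
rewrite -!PoszX -PoszD dvdzE !absz_nat => dvd_h.
rewrite /dvdn /y0 -/h -modnDmr modnMmr modnDmr expnD mulnA -expnMn h2.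
(* [2 h = 1] modulo [3^(m+1)], so [(2 h)^n] can be dropped. *)
rewrite -modnDmr -modnMml -modnXm modnDl modnXm exp1n.
by rewrite modnMml mul1n modnDmr addnC.
Qed.

Lemma x0_y0 m n : (0 < m)%N ->
  3 ^+ m * (x0 m n)%:Z = 1 + 2 ^+ n * (y0 m n)%:Z.
Proof.
move=> m_gt0; have := divnK (dvdn_x0_numerator m n m_gt0).
by rewrite -/(x0 m n) mulnC => /(congr1 Posz); rewrite PoszM PoszD PoszM !PoszX.
Qed.

(** * Arithmetic of the exponents and of [N] *)

Lemma DhatS n i : Dhat n i.+1 = (Dhat n i + n i)%N.
Proof. by rewrite /Dhat big_nat_recr //= addnA. Qed.

Lemma D_Dhat n i : (0 < n i)%N -> D n i = (Dhat n i + (n i).-1)%N.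
Proof. by rewrite /D /Dhat big_nat_recr //=; lia. Qed.

Lemma CWS n i : CW n i.+1 = CW n i ++ s ++ nseq (n i.+1).-1 d.
Proof.
rewrite /CW -[i.+1 in LHS]addn1 iotaD map_cat flatten_cat /=.
by rewrite cats0 catA add1n.
Qed.

Lemma size_CW n i : (forall j, (1 <= j <= i)%N -> (1 <= n j)%N) ->
  size (CW n i) = (D n i + i)%N.
Proof.
elim: i => [|i IH] hn.
  by rewrite /CW /D /= cats0 size_nseq big_nat1 addn0.
rewrite CWS size_cat IH; last by move=> j hj; apply: hn; lia.
rewrite size_cat size_nseq.
have : (1 <= n i.+1)%N by apply: hn; lia.
by rewrite /D [in RHS]big_nat_recr //=; lia.
Qed.

Lemma dvd3_Ntilde n i : (3 %| Ntilde n i)%Z.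
Proof. by case: i => [|[|i]] //=; rewrite -mulrA dvdz_mulr. Qed.

(** * Parametrization of the runs *)

(** [CW n i ++ s] is the word up to and including its [(i+1)]-th [s]. *)
Lemma run_CW_s n i : (forall j, (1 <= j <= i)%N -> (1 <= n j)%N) ->
  forall t : int, run (CW n i ++ s) (M n i.+1 + 2 ^+ Dhat n i.+1 * t)
                      (N n i.+1 + 3 ^+ i.+1 * t).
Proof.
elim: i => [|i IH] hn t.
  have -> : M n 1 + 2 ^+ Dhat n 1 * t = 2 ^+ n 0%N * (2 * t + 1).
    by rewrite /M /Dhat big_nat1 exprD; ring.
  have -> : N n 1 + 3 ^+ 1 * t = 3 * t + 2 by rewrite /N /=; ring.
  by rewrite /CW /= cats0; exact: (run_cat (run_nseq_d _ _) (run_s t)).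
have ni_gt0 : (0 < n i.+1)%N by apply: hn; lia.
have {IH} := IH (fun j hj => hn j ltac:(lia)).
set x := (x0 i.+1 (n i.+1))%:Z; set y := (y0 i.+1 (n i.+1))%:Z.
set ci := c n i.+1.
(* With this parameter the value reached before [d^(n_(i+1) - 1) s] is
   [2^(n_(i+1) - 1)] times the odd number [2 w + 1],
   [w = c y_0 + 3^(i+1) t]. *)
move=> /(_ (ci * x + 2 ^+ n i.+1 * t)).
have -> : N n i.+1 + 3 ^+ i.+1 * (ci * x + 2 ^+ n i.+1 * t) =
  2 ^+ (n i.+1).-1 * (2 * (ci * y + 3 ^+ i.+1 * t) + 1).
  have xy : 3 ^+ i.+1 * x = 1 + 2 ^+ n i.+1 * y by exact: x0_y0.
  have -> : N n i.+1 = 2 ^+ (n i.+1).-1 - ci by rewrite /ci /c /c_of /N; ring.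
  have -> : 3 ^+ i.+1 * (ci * x + 2 ^+ n i.+1 * t) =
    ci * (3 ^+ i.+1 * x) + 2 ^+ n i.+1 * (3 ^+ i.+1 * t) by ring.
  have pow2 : 2 ^+ n i.+1 = 2 * 2 ^+ (n i.+1).-1 :> int.
    by rewrite -exprS prednK.
  rewrite xy pow2; ring.
have -> : M n i.+2 + 2 ^+ Dhat n i.+2 * t =
  M n i.+1 + 2 ^+ Dhat n i.+1 * (ci * x + 2 ^+ n i.+1 * t).
  have -> : M n i.+2 = M n i.+1 + 2 ^+ Dhat n i.+1 * ci * x by [].
  by rewrite [Dhat n i.+2]DhatS exprD; ring.
have -> : N n i.+2 + 3 ^+ i.+2 * t = 3 * (ci * y + 3 ^+ i.+1 * t) + 2.
  have -> : N n i.+2 = 3 * y * ci + 2 by [].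
  by rewrite [3 ^+ i.+2]exprS; ring.
move=> run_i; rewrite CWS (catA (CW n i)).
exact: (run_cat (run_cat run_i (run_nseq_d _ _)) (run_s _)).
Qed.

Lemma run_CW S n k : (1 <= S)%N ->
  (forall i, (1 <= i <= S)%N -> (1 <= n i)%N) ->
  run (CW n S) (M_first n S k) (N_last n S k).
Proof.
case: S => // S _ hn.
have nS_gt0 : (0 < n S.+1)%N by apply: hn; lia.
set r := (n S.+1).-1.
set x := (x0 S.+1 r)%:Z; set y := (y0 S.+1 r)%:Z.
set z := tmin S.+1 r (c_new n S.+1) + k%:Z.
have hn' j : (1 <= j <= S)%N -> (1 <= n j)%N by move=> hj; apply: hn; lia.
have := run_CW_s n S hn' (c_new n S.+1 * x + 2 ^+ r * z).
have -> : M n S.+1 + 2 ^+ Dhat n S.+1 * (c_new n S.+1 * x + 2 ^+ r * z) =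
  M_first n S.+1 k.
  by rewrite /M_first /z D_Dhat // exprD -/r -/x /c_new; ring.
have -> : N n S.+1 + 3 ^+ S.+1 * (c_new n S.+1 * x + 2 ^+ r * z) =
  2 ^+ r * N_last n S.+1 k.
  have xy : 3 ^+ S.+1 * x = 1 + 2 ^+ r * y by exact: x0_y0.
  have -> : 3 ^+ S.+1 * (c_new n S.+1 * x + 2 ^+ r * z) =
    c_new n S.+1 * (3 ^+ S.+1 * x) + 2 ^+ r * (3 ^+ S.+1 * z) by ring.
  rewrite xy /N_last -/r -/y /c_new /z; ring.
by move=> run_S; rewrite CWS catA; exact: (run_cat run_S (run_nseq_d _ _)).
Qed.

(** * Positivity *)

Lemma ndvd3_y0 m n : (0 < m)%N -> (3 %| (y0 m n)%:Z)%Z = false.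
Proof.
move=> m_gt0; apply/negP => /dvdzP[q yq]; have := x0_y0 m n m_gt0.
rewrite yq -(prednK m_gt0) exprS -mulrA.
by move: (3 ^+ _ * _) => a; rewrite mulrA; move: (2 ^+ n * q) => b; lia.
Qed.

Lemma tmin_last_gt0 m n (c : int) : (0 < m)%N -> ~~ (3 %| c)%Z ->
  0 < c * (y0 m n)%:Z + 3 ^+ m * tmin m n c.
Proof.
move=> m_gt0 c3; rewrite /tmin; case: ifPn => c_sign.
- (* The bound by [x_0] is the stronger one:
     [2^n (c y_0 + 3^m t) = - c + 3^m (c x_0 + 2^n t)]. *)
  set t := Num.ceil _.
  have : (`|c|%:~R * (x0 m n)%:R / 2 ^+ n : rat) <= t%:~R by exact: ceil_ge.
  rewrite ler_pdivrMr ?exprn_gt0 //.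
  have -> : (2 ^+ n : rat) = (2 ^+ n : int)%:~R by rewrite rmorphXn.
  rewrite -[(x0 m n)%:R]/((x0 m n)%:Z%:~R) -!intrM ler_int ltr0_norm // => le_t.
  have xy := x0_y0 m n m_gt0.
  rewrite -(pmulr_rgt0 _ (exprn_gt0 n (ltr0Sn int 1))).
  have -> : 2 ^+ n * (c * (y0 m n)%:Z + 3 ^+ m * t) =
    - c + 3 ^+ m * (c * (x0 m n)%:Z + t * 2 ^+ n).
    rewrite [3 ^+ m * (_ + _)]mulrDr [3 ^+ m * (c * _)]mulrCA xy; ring.
  apply: ltr_wpDr; last by rewrite oppr_gt0.
  by rewrite mulr_ge0 ?exprn_ge0 //; lia.
- set t := Num.ceil _.
  have : ((- c)%:~R * (y0 m n)%:R / 3 ^+ m : rat) <= t%:~R by exact: ceil_ge.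
  rewrite ler_pdivrMr ?exprn_gt0 //.
  have -> : (3 ^+ m : rat) = (3 ^+ m : int)%:~R by rewrite rmorphXn.
  rewrite -[(y0 m n)%:R]/((y0 m n)%:Z%:~R) -!intrM ler_int => le_t.
  rewrite lt_def; apply/andP; split; last by rewrite mulrC; lia.
  apply/negP => /eqP eq0.
  have : (3 %| c * (y0 m n)%:Z)%Z.
    apply/dvdzP; exists (- (3 ^+ m.-1 * t)).
    have pow3 : 3 ^+ m = 3 * 3 ^+ m.-1 :> int by rewrite -exprS prednK.
    by move/eqP: eq0; rewrite pow3 addr_eq0 => /eqP ->; ring.
  rewrite dvdzE abszM Euclid_dvdM // -[(3 %| `|c|)%N]/(3 %| c)%Z (negPf c3).
  by have := ndvd3_y0 m n m_gt0; rewrite dvdzE => ->.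
Qed.

Lemma N_last_gt0 S n k : (1 <= S)%N -> 0 < N_last n S k.
Proof.
move=> S_gt0; apply: ltr_wpDr; first by rewrite mulr_ge0 ?exprn_ge0.
apply: tmin_last_gt0 => //; rewrite /c_new /N.
by have := dvd3_Ntilde n S; lia.
Qed.

Theorem theorem9 (S : nat) (n : nat -> nat) (hS : (1 <= S)%N)
    (hn : forall i : nat, (1 <= i <= S)%N -> (1 <= n i)%N) (k : nat) :
  [/\ 0 < M_first n S k,
      realizes (CW n S) (CS n S k)
    & last 0 (CS n S k) = N_last n S k].
Proof.
have run_S := run_CW S n k hS hn.
have [real_S last_S] := run_realizes _ _ _ run_S.
have -> : CS n S k = traject collatz (M_first n S k) (size (CW n S)).+1.
  by rewrite /CS /L size_CW // addn1.
split=> //.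
exact: run_gt0 run_S (N_last_gt0 S n k hS).
Qed.
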